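(* Let $n\ge 1$ and $t\ge 0$ be integers. The number of permutations $\pi\in S_n$ that are $t$-stack-sortable under $s_{1\dot{2}}$ equals $n!$ if $n\le t$, and equals $t!\cdot (t+1)^{\,n-t}$ if $n>t$.
   Context: The $1\dot{2}$-avoiding stack-sorting map $s_{1\dot{2}}$ is defined as follows. Start with the input $\pi$ and an empty stack. Repeat the following step until both the input and the stack are empty: - If input remains, and either the stack is empty or the next input entry is smaller than the entry at the bottom of the stack, push the next input entry onto the top of the stack. - Otherwise, pop the top entry of the stack and append it to the output. The output word is $s_{1\dot{2}}(\pi)$. For an integer $t\ge 0$, a permutation $\pi\in S_n$ is called $t$-stack-sortable (under $s_{1\dot{2}}$) if $s_{1\dot{2}}^{\,t}(\pi)$, the $t$-fold iterate applied to $\pi$, equals the identity $12\cdots n$. *)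

(* Defs.v *)
From mathcomp Require Import all_boot all_order all_fingroup.
Set Implicit Arguments. Unset Strict Implicit. Unset Printing Implicit Defensive.

(* The stack is a list whose head is the TOP and whose last element is the
   BOTTOM.  One step of the 1\dot{2}-avoiding stack-sorting procedure on the
   state (input, stack, output-so-far).  [fuel] bounds the number of steps;
   each entry is pushed once and popped once, so fuel = 2 * size suffices. *)
Fixpoint s12_run (fuel : nat) (inp stk out : seq nat) : seq nat :=
  match fuel with
  | 0 => out ++ stk
  | f.+1 =>
    match inp, stk with
    | [::], [::] => out
    | x :: inp', [::] => s12_run f inp' [:: x] out
    | x :: inp', y :: stk' =>
        if x < last y stk'
        then s12_run f inp' (x :: stk) out
        else s12_run f inp stk' (rcons out y)
    | [::], y :: stk' => s12_run f [::] stk' (rcons out y)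
    end
  end.

Definition s12 (w : seq nat) : seq nat := s12_run (2 * size w) w [::] [::].

(* One-line notation of a permutation of 'I_n (entries 0..n-1). *)
Definition oneline n (p : 'S_n) : seq nat := [seq val (p i) | i <- enum 'I_n].

Definition t_sortable (t n : nat) (p : 'S_n) : bool :=
  iter t s12 (oneline p) == iota 0 n.

(* Main.v *)
Require Import Defs.
From mathcomp Require Import all_boot all_order all_fingroup.
From mathcomp Require Import zify.

(** The map reverses every block of a word, where a block starts at a weak
    left-to-right maximum.  Deleting the least entry therefore commutes with
    the map, so permutations of size [n + 1] can be counted by inserting a new
    least entry into permutations of size [n].  One pass fixes the gap [0] in
    front of a word of size [n] and sends the gaps [1 .. n] bijectively to
    [0 .. n - 1].  After one pass the maximum is last, which forces the gap [n]
    to move left by exactly one at each later pass.  Hence, whatever the word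
    is, exactly one gap reaches the front for the first time at each of the
    times [0 .. n], so [(minn n t).+1] insertions survive [t] passes. *)

Set Implicit Arguments.
Unset Strict Implicit.
Unset Printing Implicit Defensive.

(** * Big-step form of the stack-sorting map *)

(* For an empty stack the junk bottom [last 0 [::] = 0] makes the test fail,
   and the second branch is then a plain push. *)
Fixpoint sweep (stk inp : seq nat) : seq nat :=
  if inp is x :: inp' then
    if x < last 0 stk then sweep (x :: stk) inp' else stk ++ sweep [:: x] inp'
  else stk.

(** An input entry still needs a push and a pop, a stack entry only a pop; the fuel bound counts
    these steps. *)
Lemma s12_run_sweep fuel inp stk out :
  2 * size inp + size stk <= fuel ->
  s12_run fuel inp stk out = out ++ sweep stk inp.
Proof.
elim: fuel inp stk out => [|f IH] [|x inp] [|y stk] out //=; try lia.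
- by rewrite cats0.
- by move=> h; rewrite IH /= ?cat_rcons //; lia.
- by move=> h; rewrite IH //=; lia.
case: ifP => xy h; first by rewrite IH //=; lia.
rewrite IH /=; last lia.
(* Only the top [y] has been popped. If entries remain, the bottom is the same, so the test fails
   again and the flush goes on. *)
case: stk xy h => [|z stk] /= xy h; first by rewrite cat_rcons.
by rewrite xy cat_rcons.
Qed.

Lemma s12E w : s12 w = sweep [::] w.
Proof. by rewrite /s12 s12_run_sweep // addn0. Qed.

Lemma perm_sweep stk inp : perm_eq (sweep stk inp) (stk ++ inp).
Proof.
elim: inp stk => [|x inp IH] stk /=; first by rewrite cats0.
case: ifP => _; last by rewrite perm_cat2l IH.
by apply: perm_trans (IH _) _; rewrite -cat1s -catA perm_catCA.
Qed.

Lemma perm_s12 w : perm_eq (s12 w) w.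
Proof. by rewrite s12E perm_sweep. Qed.

Lemma size_s12 w : size (s12 w) = size w.
Proof. exact: perm_size (perm_s12 w). Qed.

Lemma sweep_map_succ stk inp :
  sweep (map S stk) (map S inp) = map S (sweep stk inp).
Proof.
elim: inp stk => [|x inp IH] stk //=.
(* For an empty stack both sides compare with the default [0] and are false. *)
have -> : (x.+1 < last 0 (map S stk)) = (x < last 0 stk).
  by case/lastP: stk => [|stk y] //; rewrite map_rcons !last_rcons.
by case: ifP => _; rewrite -?map_cons ?map_cat -IH.
Qed.

Lemma iter_s12_map_succ t w : iter t s12 (map S w) = map S (iter t s12 w).
Proof. by elim: t => //= t ->; rewrite !s12E -sweep_map_succ. Qed.

Lemma size_iter_s12 t w : size (iter t s12 w) = size w.
Proof. by elim: t => //= t <-; rewrite size_s12. Qed.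

(** * Inserting a least entry *)

Definition insert0 g (w : seq nat) := take g w ++ 0 :: drop g w.

Lemma insert0_cat g (u v : seq nat) :
  g <= size u -> insert0 g u ++ v = insert0 g (u ++ v).
Proof.
move=> gu; rewrite /insert0 -catA take_cat drop_cat /=.
case: ltnP => // ug; have -> : g = size u by lia.
by rewrite subnn take0 drop0 cats0 take_size drop_size.
Qed.

Lemma cat_insert0 g (u v : seq nat) :
  u ++ insert0 g v = insert0 (size u + g) (u ++ v).
Proof.
by rewrite /insert0 take_cat drop_cat ltnNge leq_addr /= addKn catA.
Qed.

Lemma last_insert0 g w : g < size w -> last 0 (insert0 g w) = last 0 w.
Proof.
move=> gw; rewrite -{2}(cat_take_drop g w) /insert0 !last_cat /=.
by case: (drop g w) (size_drop g w) => //=; lia.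
Qed.

(* [stack_gap] and [input_gap] give the position in the output [sweep stk inp]
   of a new least entry inserted at position [g] of the stack, resp. input. *)
Fixpoint stack_gap (stk inp : seq nat) g :=
  if inp is x :: inp' then
    if x < last 0 stk then stack_gap (x :: stk) inp' g.+1 else g
  else g.

Fixpoint input_gap (stk inp : seq nat) g {struct g} :=
  match g, inp with
  | 0, _ => stack_gap stk inp 0
  | g'.+1, x :: inp' =>
    if x < last 0 stk then input_gap (x :: stk) inp' g'
    else size stk + input_gap [:: x] inp' g'
  | _.+1, [::] => 0
  end.

Lemma input_gap_cons stk x inp g :
  input_gap stk (x :: inp) g.+1
  = if x < last 0 stk then input_gap (x :: stk) inp g
    else size stk + input_gap [:: x] inp g.
Proof. by []. Qed.

(** The bound on [g] keeps [0] above the bottom, so every test has the same outcome as without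
    it. *)
Lemma sweep_insert0_stack stk inp g : g < size stk ->
  sweep (insert0 g stk) inp = insert0 (stack_gap stk inp g) (sweep stk inp).
Proof.
elim: inp stk g => [|x inp IH] stk g gs //=.
rewrite last_insert0 //; case: ifP => _; first by rewrite -IH.
by rewrite insert0_cat // ltnW.
Qed.

(** Every bottom is positive, so [0] is pushed as soon as it is read and never becomes a bottom
    itself. *)
Lemma sweep_insert0 stk inp g :
  stk != [::] -> 0 \notin stk -> 0 \notin inp -> g <= size inp ->
  sweep stk (insert0 g inp) = insert0 (input_gap stk inp g) (sweep stk inp).
Proof.
have push0 stk' inp' : stk' != [::] -> 0 \notin stk' ->
    sweep stk' (0 :: inp')
    = insert0 (stack_gap stk' inp' 0) (sweep stk' inp').
  case/lastP: stk' => [//|s y] _.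
  rewrite mem_rcons inE negb_or eq_sym -lt0n => /andP[y0 _] /=.
  rewrite last_rcons y0 -sweep_insert0_stack ?size_rcons //.
  by rewrite /insert0 take0 drop0.
elim: inp stk g => [|x inp IH] stk [|g] ns s0 //.
- by move=> _ _; exact: push0.
- by move=> _ _; exact: push0.
rewrite inE negb_or => /andP[x0 i0] gi /=.
case: ifP => _; first by rewrite -IH // inE negb_or x0.
by rewrite -cat_insert0 -IH // inE.
Qed.

(** * The gap map of one pass and its iterates *)

Definition gap w g := input_gap [::] w g.

Lemma gap0 w : gap w 0 = 0.
Proof. by case: w. Qed.

Lemma gap_nil g : gap [::] g = 0.
Proof. by case: g. Qed.

Lemma s12_insert0 w g : 0 \notin w -> g <= size w ->
  s12 (insert0 g w) = insert0 (gap w g) (s12 w).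
Proof.
rewrite !s12E; case: w g => [|x w] [|g] //.
  by rewrite gap0 /insert0 /= take0 drop0.
rewrite inE negb_or => /andP[x0 w0] gw.
by have := @sweep_insert0 [:: x] w g isT; rewrite inE => /(_ x0 w0 gw).
Qed.

Lemma iota_succ m n : iota m.+1 n = map S (iota m n).
Proof. exact: (iotaDl 1 m n). Qed.

(* The gaps [1 .. size stk - 1] inside the stack complete the image of the
   input gaps to an initial segment. *)
Lemma perm_input_gap stk inp : stk != [::] ->
  perm_eq ([seq input_gap stk inp g | g <- iota 0 (size inp).+1]
           ++ [seq stack_gap stk inp g | g <- iota 1 (size stk).-1])
          (iota 0 (size stk + size inp)).
Proof.
elim: inp stk => [|x inp IH] stk ns.
  by rewrite /= map_id addn0; case: stk ns.
rewrite -[iota 0 (size (x :: inp)).+1]/(0 :: iota 1 (size inp).+1).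
rewrite [iota 1 (size inp).+1]iota_succ map_cons -map_comp.
case xs: (x < last 0 stk).
  have -> : map (input_gap stk (x :: inp) \o succn) (iota 0 (size inp).+1)
      = map (input_gap (x :: stk) inp) (iota 0 (size inp).+1).
    by apply: eq_map => g /=; rewrite xs.
  have -> : map (stack_gap stk (x :: inp)) (iota 1 (size stk).-1)
      = map (stack_gap (x :: stk) inp) (iota 2 (size stk).-1).
    by rewrite (iota_succ 1) -map_comp; apply: eq_map => g /=; rewrite xs.
  have := IH (x :: stk) isT.
  (* Pushing [x] turns the gap on top of [stk] into the inner gap [1] of [x :: stk]; it stands for
     input gap [0]. *)
  have -> : iota 1 (size (x :: stk)).-1 = 1 :: iota 2 (size stk).-1.
    by case: stk ns {xs}.
  rewrite [size (x :: stk) + _]addSnnS map_cons; apply: perm_trans.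
  rewrite [input_gap stk _ 0]/= xs cat_cons -cat1s.
  by rewrite -[X in perm_eq _ (_ ++ X)]cat1s perm_catCA.
(* Here the stack is flushed: its own gaps stay in place, and all later ones shift by [size stk]. *)
have -> : map (input_gap stk (x :: inp) \o succn) (iota 0 (size inp).+1)
    = map (addn (size stk)) (map (input_gap [:: x] inp) (iota 0 (size inp).+1)).
  by rewrite -map_comp; apply: eq_map => g /=; rewrite xs.
have -> : map (stack_gap stk (x :: inp)) (iota 1 (size stk).-1)
    = iota 1 (size stk).-1.
  by apply: map_id_in => g _ /=; rewrite xs.
have := IH [:: x] isT; rewrite cats0 [_ + size inp]add1n => {}IH.
rewrite [input_gap _ _ 0]/= xs iotaD add0n.
have -> : iota 0 (size stk) = 0 :: iota 1 (size stk).-1 by case: stk ns {xs}.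
rewrite 2!cat_cons perm_cons perm_catC perm_cat2l.
rewrite -{2}[size stk]addn0 iotaDl.
by rewrite perm_map.
Qed.

(** The first entry is always pushed, and a stack of one entry has no inner gap, so the stack term
    of [perm_input_gap] vanishes. *)
Lemma perm_gap w :
  perm_eq [seq gap w g | g <- iota 1 (size w)] (iota 0 (size w)).
Proof.
case: w => [//|x w]; have := perm_input_gap w (stk := [:: x]) isT.
rewrite cats0 [_ + size w]add1n.
by rewrite -[size (x :: w)]/(size w).+1 [iota 1 _]iota_succ -map_comp.
Qed.

Lemma gap_le w g : g <= size w -> gap w g <= size w.
Proof.
case: g => [|g] gw; first by rewrite gap0.
suff : gap w g.+1 \in iota 0 (size w) by rewrite mem_iota => /andP[_ /ltnW].
by rewrite -(perm_mem (perm_gap w)) map_f // mem_iota.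
Qed.

Fixpoint gap_iter t w g :=
  if t is t'.+1 then gap_iter t' (s12 w) (gap w g) else g.

Lemma gap_iter0 t w : gap_iter t w 0 = 0.
Proof. by elim: t w => //= t IH w; rewrite gap0. Qed.

Lemma gap_iter_le t w g : g <= size w -> gap_iter t w g <= size w.
Proof.
elim: t w g => //= t IH w g gw.
by rewrite -(size_s12 w) IH // size_s12 gap_le.
Qed.

Lemma iter_s12_insert0 t w g : 0 \notin w -> g <= size w ->
  iter t s12 (insert0 g w) = insert0 (gap_iter t w g) (iter t s12 w).
Proof.
elim: t w g => // t IH w g w0 gw; rewrite !iterSr /= -IH ?s12_insert0 //.
  by rewrite (perm_mem (perm_s12 w)).
by rewrite size_s12 gap_le.
Qed.

(** * Words ending with a maximum *)

Lemma last_push x stk : x < last 0 stk -> last 0 (x :: stk) = last 0 stk.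
Proof. by case: stk. Qed.

Lemma sweep_rcons_max stk inp m : last 0 stk <= m -> all (leq^~ m) inp ->
  sweep stk (rcons inp m) = rcons (sweep stk inp) m.
Proof.
elim: inp stk => [|x inp IH] stk sm /=; first by rewrite ltnNge sm cats1.
by case/andP=> xm im; case: ifP => xs;
  rewrite IH ?(@last_push x stk) ?rcons_cat.
Qed.

Lemma s12_rcons_max w m :
  all (leq^~ m) w -> s12 (rcons w m) = rcons (s12 w) m.
Proof. by move=> wm; rewrite !s12E sweep_rcons_max. Qed.

Lemma stack_gap_rcons_max stk inp m g : last 0 stk <= m ->
  all (leq^~ m) inp -> stack_gap stk (rcons inp m) g = stack_gap stk inp g.
Proof.
elim: inp stk g => [|x inp IH] stk g sm /=; first by rewrite ltnNge sm.
by case/andP=> xm im; case: ifP => xs //; rewrite IH ?(@last_push x stk).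
Qed.

Lemma input_gap_rcons_max stk inp m g : last 0 stk <= m ->
  all (leq^~ m) inp -> g <= size inp ->
  input_gap stk (rcons inp m) g = input_gap stk inp g.
Proof.
elim: inp stk g => [|x inp IH] stk [|g] sm im // gi.
- by rewrite /= ltnNge sm.
- exact: stack_gap_rcons_max.
case/andP: im => xm im /=.
by case: ifP => xs; rewrite IH ?(@last_push x stk).
Qed.

(** A least entry behind [m] is pushed onto the stack [[:: m]], hence leaves just before [m]. *)
Lemma input_gap_rcons_max_size stk inp m : last 0 stk <= m ->
  all (leq^~ m) inp ->
  input_gap stk (rcons inp m) (size inp).+1 = size stk + size inp.
Proof.
elim: inp stk => [|x inp IH] stk sm; first by rewrite /= ltnNge sm.
case/andP=> xm im; rewrite rcons_cons input_gap_cons.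
by case: ifP => xs; rewrite IH ?(@last_push x stk) //= addnS ?addSn.
Qed.

Lemma gap_iter_rcons_max t w m g : all (leq^~ m) w -> g <= size w ->
  gap_iter t (rcons w m) g = gap_iter t w g.
Proof.
elim: t w g => //= t IH w g wm gw.
rewrite s12_rcons_max // /gap input_gap_rcons_max // IH //.
  by rewrite (perm_all _ (perm_s12 w)).
by rewrite size_s12 gap_le.
Qed.

(** Each new bottom is at least the old one, and the final bottom is output last. The empty stack
    gives the case of a full pass. *)
Lemma sweep_le_last stk inp : all (leq^~ (last 0 stk)) stk ->
  all (leq^~ (last 0 (sweep stk inp))) (sweep stk inp).
Proof.
elim: inp stk => [|x inp IH] stk //= sm.
case: ifP => xs.
  by apply: IH; rewrite last_push //= (ltnW xs).
have := IH [:: x]; rewrite /= leqnn => /(_ isT) sw.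
have xw : x \in sweep [:: x] inp.
  by rewrite (perm_mem (perm_sweep _ _)) inE eqxx.
have xl := allP sw _ xw.
rewrite last_cat all_cat.
have -> : last (last 0 stk) (sweep [:: x] inp) = last 0 (sweep [:: x] inp).
  by case: (sweep _ _) xw.
rewrite sw andbT; apply: sub_all sm => y /leq_trans -> //.
by rewrite (leq_trans _ xl) // leqNgt xs.
Qed.

Lemma gap_iter_s12_size t w :
  (gap_iter t (s12 w) (size w) == 0) = (size w <= t).
Proof.
elim: t w => [|t IH] w /=; first by rewrite leqn0.
have := @sweep_le_last [::] w isT; rewrite -s12E -size_s12.
case/lastP: (s12 w) => [|u m]; first by rewrite gap_nil gap_iter0.
(* The last gap moves to just before the maximum [m]. Without [m] it is the last gap of [s12 u], so
   [IH] applies to the shorter word [u]. *)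
rewrite last_rcons all_rcons size_rcons ltnS => /andP[_ um].
rewrite s12_rcons_max // /gap input_gap_rcons_max_size // add0n.
rewrite gap_iter_rcons_max ?size_s12 //.
by rewrite (perm_all _ (perm_s12 u)).
Qed.

Lemma count_gap_iter t w :
  count (fun g => gap_iter t w g == 0) (iota 0 (size w).+1)
  = (minn (size w) t).+1.
Proof.
elim: t w => [|t IH] w.
  rewrite minn0 /=; congr _.+1; apply/eqP; rewrite -leqn0 leqNgt -has_count.
  by apply/hasPn => g; rewrite mem_iota; lia.
rewrite /= gap0 gap_iter0 add1n; congr _.+1.
rewrite -(count_map (gap w) (fun g => gap_iter t (s12 w) g == 0)).
rewrite (seq.permP (perm_gap w)).
(* [IH] also counts the gap [size w] of [s12 w], which is no image of a positive gap; it contributes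
   one exactly when [size w <= t]. *)
have := IH (s12 w); rewrite size_s12 -addn1 iotaD count_cat /=.
by rewrite add0n gap_iter_s12_size; lia.
Qed.

(** * Counting permutations by inserting least entries *)

Fixpoint perm_words n : seq (seq nat) :=
  if n is n'.+1 then
    [seq insert0 g (map S w) | w <- perm_words n', g <- iota 0 n'.+1]
  else [:: [::]].

Lemma size_perm_words n : size (perm_words n) = n`!.
Proof.
by elim: n => // n IH; rewrite [LHS]size_allpairs IH size_iota mulnC.
Qed.

Lemma perm_insert0 g w : perm_eq (insert0 g w) (0 :: w).
Proof.
by rewrite /insert0 -(cat1s 0 (drop g w)) perm_catCA /= perm_cons cat_take_drop.
Qed.

Lemma insert0_index w : 0 \in w -> insert0 (index 0 w) (rem 0 w) = w.
Proof.
move=> w0; rewrite remE /insert0.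
have ts : size (take (index 0 w) w) = index 0 w.
  by rewrite size_takel ?index_size.
rewrite take_cat drop_cat ts ltnn subnn take0 drop0 cats0.
rewrite -[X in _ ++ X :: _](nth_index 0 w0) -drop_nth ?index_mem //.
exact: cat_take_drop.
Qed.

(** Removing [0] and lowering the other entries by one is undone by inserting [0] at its old
    index. *)
Lemma mem_perm_words n w : perm_eq w (iota 0 n) -> w \in perm_words n.
Proof.
elim: n w => [|n IH] w pw; first by rewrite mem_seq1; apply/eqP/perm_nilP.
have w0 : 0 \in w by rewrite (perm_mem pw).
have pr : perm_eq (rem 0 w) (iota 1 n).
  rewrite -(perm_cons 0); apply: perm_trans pw.
  by rewrite perm_sym perm_to_rem.
have predK : map S (map predn (rem 0 w)) = rem 0 w.
  rewrite -map_comp map_id_in // => x; rewrite (perm_mem pr) mem_iota /=.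
  by move=> /andP[x0 _]; rewrite prednK.
apply/allpairsP; exists (map predn (rem 0 w), index 0 w); split.
- apply: IH; have := perm_map predn pr.
  by rewrite iota_succ -map_comp map_id.
- rewrite mem_iota add0n.
  by rewrite -(size_iota 0 n.+1) -(perm_size pw) index_mem.
- by rewrite /= predK insert0_index.
Qed.

Lemma size_of_perm_words n w : w \in perm_words n -> size w = n.
Proof.
elim: n w => [|n IH] w; first by rewrite mem_seq1 => /eqP->.
case/allpairsP => -[u g] [/= /IH us _ ->].
by rewrite (perm_size (perm_insert0 _ _)) /= size_map us.
Qed.

Lemma insert0_eq_iota g w n : g <= size w ->
  (insert0 g (map S w) == iota 0 n.+1) = (g == 0) && (w == iota 0 n).
Proof.
move=> gw; apply/eqP/andP => [|[/eqP-> /eqP->]]; last first.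
  by rewrite /insert0 take0 drop0 /= iota_succ.
case: g gw => [_|g]; last by case: w.
rewrite /insert0 take0 drop0 /= iota_succ => -[].
by move/(inj_map succn_inj) ->.
Qed.

Lemma count_perm_words t n :
  count (fun w => iter t s12 w == iota 0 n) (perm_words n)
  = \prod_(i < n) (minn i t).+1.
Proof.
elim: n => [|n IH].
  rewrite big_ord0 /= addn0; suff -> : iter t s12 [::] = [::] by [].
  by apply: size0nil; rewrite size_iter_s12.
rewrite big_ord_recr [RHS]/= -IH.
rewrite -[perm_words n.+1]/[seq insert0 g (map S w) | w <- perm_words n,
                                                    g <- iota 0 n.+1].
rewrite count_flatten -map_comp sumnE big_map.
rewrite -sum1_count big_distrl [RHS]big_mkcond.
rewrite !big_seq; apply: eq_bigr => w /size_of_perm_words ws.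
rewrite [LHS]count_map [RHS]/= mul1n.
(* The extended word gets sorted exactly when [w] does and the new [0] reaches the front; the first
   condition is free of [g]. *)
rewrite (@eq_in_count _ _ (fun g => (iter t s12 w == iota 0 n)
    && (gap_iter t (map S w) g == 0))); last first.
  move=> g; rewrite mem_iota ltnS -ws => /= gw.
  have S0 : 0 \notin map S w by apply/negP => /mapP[].
  rewrite iter_s12_insert0 ?size_map //.
  rewrite iter_s12_map_succ insert0_eq_iota 1?andbC //.
  by rewrite size_iter_s12 -(size_map S) gap_iter_le // size_map.
case: (_ == iota 0 n) => /=; last by rewrite count_pred0.
by have := count_gap_iter t (map S w); rewrite size_map ws.
Qed.

(** * One-line notations and the list of words *)

Lemma oneline_inj n : injective (@oneline n).
Proof.
move=> p q /eq_in_map pq; apply/permP => i; apply: val_inj.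
by apply: pq; rewrite mem_enum.
Qed.

Lemma perm_oneline n (p : 'S_n) : perm_eq (oneline p) (iota 0 n).
Proof.
rewrite -val_enum_ord /oneline map_comp perm_map //.
apply: uniq_perm.
- by rewrite map_inj_uniq ?enum_uniq //; exact: perm_inj.
- exact: enum_uniq.
- by move=> i; rewrite mem_enum inE -[i](permKV p) map_f ?mem_enum.
Qed.

(** The one-line notations are distinct and lie in [perm_words n]; as both lists have length [n!],
    the latter cannot have repetitions or further members. *)
Lemma perm_onelines n :
  perm_eq [seq oneline p | p <- enum 'S_n] (perm_words n).
Proof.
have u : uniq [seq oneline p | p <- enum 'S_n].
  by rewrite map_inj_uniq ?enum_uniq //; exact: oneline_inj.
have sub : {subset [seq oneline p | p <- enum 'S_n] <= perm_words n}.
  by move=> _ /mapP[p _ ->]; exact/mem_perm_words/perm_oneline.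
have sz : size (perm_words n) <= size [seq oneline p | p <- enum 'S_n].
  by rewrite size_map -cardE size_perm_words card_Sn.
have [_ e] := uniq_min_size u sub sz.
exact: uniq_perm u (leq_size_uniq u sub sz) e.
Qed.

Lemma prod_minn n t : \prod_(i < n) (minn i t).+1
  = if n <= t then n`! else t`! * t.+1 ^ (n - t).
Proof.
elim: n => [|n IH]; first by rewrite big_ord0.
rewrite big_ord_recr /= IH; case: (ltngtP n t) => [nt|nt|->].
- by rewrite factS mulnC.
- by rewrite subSn 1?ltnW // expnSr mulnA.
- by rewrite subSnn expn1.
Qed.

Theorem theorem3p4 (n t : nat) : 1 <= n ->
  #|[set p : 'S_n | t_sortable t p]| =
    (if n <= t then n`! else t`! * t.+1 ^ (n - t)).
Proof.
move=> _; rewrite -prod_minn -count_perm_words -(seq.permP (perm_onelines n)).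
rewrite count_map cardsE cardE /enum_mem size_filter count_filter.
by apply: eq_count => p /=; rewrite !inE andbT.
Qed.
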